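(* If $\varphi_1$ and $\varphi_2$ are PC-irredundant CNF formulas representing the same Boolean function of $n$ variables, then $|\varphi_2|\le n^2|\varphi_1|$.
   Context: A CNF formula is a set of clauses; $|\varphi|$ is its number of clauses. A partial assignment $\alpha$ of variables $\mathbf{x}$ is a set of literals on $\mathbf{x}$ with no complementary pair, identified with the conjunction of its literals. Unit resolution derives $C\setminus\{l\}$ from a clause $C\ni l$ and the unit clause $\neg l$; $\varphi\vdash_1 C$ means derivability by repeated unit resolution; $\bot$ is the empty clause. $\varphi(\mathbf{x})$ is propagation complete (PC) if for every partial assignment $\alpha$ of $\mathbf{x}$ and every literal $l$ on $\mathbf{x}$ with $\varphi\wedge\alpha\models l$ we have $\varphi\wedge\alpha\vdash_1 l$ or $\varphi\wedge\alpha\vdash_1\bot$. A PC formula is PC-irredundant if removing any single clause from it either changes the represented function or yields a formula that is not PC. Both formulas are on the same $n$ variables (no auxiliary variables).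
   Formalization: It is additionally assumed that n ≥ 2 if φ1 contains the empty clause; otherwise the bound fails, e.g. for n = 1 with φ1 = {⊥}, φ2 = {x, ¬x}, and for n = 0 with φ1 = φ2 = {⊥}. *)

(* Defs.v *)
From mathcomp Require Import all_boot.
Set Implicit Arguments. Unset Strict Implicit. Unset Printing Implicit Defensive.

(* (x, true) is the literal x, (x, false) is its negation. *)
Notation lit n := ('I_n * bool)%type.
Notation clause n := {set lit n}.
Notation cnf n := {set clause n}.

Section PropagationComplete.
Variable n : nat.
Implicit Types (l : lit n) (C : clause n) (phi : cnf n).

Definition neg_lit l : lit n := (l.1, ~~ l.2).

Definition eval_clause C (a : {ffun 'I_n -> bool}) : bool :=
  [exists l in C, a l.1 == l.2].

Definition eval_cnf phi (a : {ffun 'I_n -> bool}) : bool :=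
  [forall C in phi, eval_clause C a].

Definition represents phi (f : {ffun 'I_n -> bool} -> bool) : Prop :=
  forall a, eval_cnf phi a = f a.

Definition entails phi C : Prop :=
  forall a, eval_cnf phi a -> eval_clause C a.

Inductive unit_derives phi : clause n -> Prop :=
| unit_derives_in C : C \in phi -> unit_derives phi C
| unit_derives_res C l :
    unit_derives phi C -> l \in C -> unit_derives phi [set neg_lit l] ->
    unit_derives phi (C :\ l).

Definition partial_assignment (alpha : {set lit n}) : Prop :=
  forall l, l \in alpha -> neg_lit l \notin alpha.

Definition cnf_with phi (alpha : {set lit n}) : cnf n :=
  phi :|: [set [set l] | l in alpha].

Definition PC phi : Prop :=
  forall (alpha : {set lit n}) l,
    partial_assignment alpha ->
    entails (cnf_with phi alpha) [set l] ->
    unit_derives (cnf_with phi alpha) [set l]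
    \/ unit_derives (cnf_with phi alpha) set0.

Definition PC_irredundant phi : Prop :=
  PC phi /\
  forall C, C \in phi ->
    ~ (eval_cnf (phi :\ C) =1 eval_cnf phi) \/ ~ PC (phi :\ C).

End PropagationComplete.

(* Main.v *)
Require Import Defs.
From mathcomp Require Import all_boot.
From mathcomp Require Import zify.
Set Implicit Arguments. Unset Strict Implicit. Unset Printing Implicit Defensive.

(** For a clause [C] of [phi1] and a literal [l] of [C], the formula [phi2],
    being PC, derives [l] or the empty clause from the negations of the other
    literals of [C].  Each clause used in such a propagation assigns a new
    variable, except for one that may end in a conflict, so few clauses of
    [phi2] suffice; over all [l] in [C], at most [n ^ 2].  The clauses of
    [phi2] collected in this way simulate every propagation step of [phi1], so
    they already form a PC formula equivalent to [phi2], and irredundancy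
    forces them to be all of [phi2]. *)

Lemma card_bigcup_leq (I T : finType) (P : pred I) (F : I -> {set T}) :
  #|\bigcup_(i | P i) F i| <= \sum_(i | P i) #|F i|.
Proof.
elim/big_rec2: _ => [|i m A _ le]; first by rewrite cards0.
by apply: leq_trans (leq_card_setU _ _) _; rewrite leq_add2l.
Qed.

Section UnitPropagation.
Variable n : nat.
Implicit Types (l : lit n) (C D G : clause n) (phi theta : cnf n).
Implicit Types (alpha L : {set lit n}) (a : {ffun 'I_n -> bool}).

(** * Literals, consistent sets and closure under unit propagation *)

Lemma neg_litK : involutive (@neg_lit n).
Proof. by case=> x b; rewrite /neg_lit /= negbK. Qed.

Lemma neg_lit_neq l : neg_lit l != l.
Proof. by apply/eqP => /(congr1 snd) /=; case: (l.2). Qed.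

Definition falsified L C := [forall l in C, neg_lit l \in L].

Lemma falsifiedP L C :
  reflect (forall l, l \in C -> neg_lit l \in L) (falsified L C).
Proof. exact: 'forall_implyP. Qed.

(** The conflict-free fixed points of unit propagation; they serve as certificates that a literal is
    not derivable. *)
Definition propagation_closed phi L : Prop :=
  forall D, D \in phi -> ~~ falsified L D /\
    forall l, l \in D -> falsified L (D :\ l) -> l \in L.

Definition tautological C := [exists l in C, neg_lit l \in C].

Lemma tautologicalPn C : ~~ tautological C <-> partial_assignment C.
Proof.
split=> [/exists_inPn H l lC | H]; first exact: H.
by apply/exists_inPn => l /H.
Qed.

(** A consistent set has at most one literal per variable, so projecting to variables is injective
    on it. *)
Lemma card_partial_assignment L : partial_assignment L -> #|L| <= n.
Proof.
move=> consL; rewrite -[X in _ <= X]card_ord -(card_in_imset (f := fst)).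
  exact: max_card.
move=> [x b] [y c] xL yL /= xy; move: (consL _ xL) yL; rewrite -xy /neg_lit /=.
by case: b xL; case: c => //= xL /negbTE ->.
Qed.

(** * Unit derivations compared with closed literal sets *)

Lemma unit_derivesS phi theta C :
  theta \subset phi -> unit_derives theta C -> unit_derives phi C.
Proof.
move=> /subsetP sub; elim=> [D /sub|D l _ IH lD _ IH'].
  exact: unit_derives_in.
exact: unit_derives_res.
Qed.

Lemma cnf_withS phi theta alpha :
  theta \subset phi -> cnf_with theta alpha \subset cnf_with phi alpha.
Proof. exact: setSU. Qed.

Lemma unit_derives_assumption phi alpha l :
  l \in alpha -> unit_derives (cnf_with phi alpha) [set l].
Proof.
by move=> la; apply: unit_derives_in; rewrite inE; apply/orP; right; apply/imsetP; exists l.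
Qed.

(** The literals of [C] are resolved away one at a time; those absent from [D] cost no step. *)
Lemma unit_derives_setD phi C D :
  unit_derives phi D ->
  (forall l, l \in C -> unit_derives phi [set neg_lit l]) ->
  unit_derives phi (D :\: C).
Proof.
move=> derD; have [k] := ubnP #|C|; elim: k C => // k IH C ltk derC.
have [->|[l lC]] := set_0Vmem C; first by rewrite setD0.
have -> : D :\: C = (D :\: (C :\ l)) :\ l.
  by apply/setP=> x; rewrite !inE; case: eqP => [->|]; rewrite ?lC //= andbT.
have derDl : unit_derives phi (D :\: (C :\ l)).
  apply: IH => [|x /setD1P[_ /derC] //].
  by move: ltk; rewrite (cardsD1 l C) lC.
have [lD|lD] := boolP (l \in D :\: (C :\ l)).
  by apply: unit_derives_res => //; exact: derC.
suff -> : (D :\: (C :\ l)) :\ l = D :\: (C :\ l) by [].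
by apply/setP=> x; rewrite in_setD1; case: eqP => // ->; rewrite (negbTE lD).
Qed.

Lemma unit_derives_falsified phi D L :
  D \in phi -> (forall l, l \in L -> unit_derives phi [set l]) ->
  falsified L D -> unit_derives phi set0.
Proof.
move=> Dphi derL /falsifiedP fal; rewrite -(setDv D).
by apply: unit_derives_setD => [|l /fal /derL //]; exact: unit_derives_in.
Qed.

Lemma unit_derives_unit phi D L l :
  D \in phi -> (forall l, l \in L -> unit_derives phi [set l]) ->
  l \in D -> falsified L (D :\ l) -> unit_derives phi [set l].
Proof.
move=> Dphi derL lD /falsifiedP fal.
have -> : [set l] = D :\: (D :\ l).
  by apply/setP=> x; rewrite !inE; case: eqP => [->|_]; rewrite ?lD //= andNb.
by apply: unit_derives_setD => [|x /fal /derL //]; exact: unit_derives_in.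
Qed.

(* Every derived clause is some clause of the formula with literals removed
   whose negations lie in L. *)
Lemma unit_derives_closed phi alpha L G :
  partial_assignment L -> alpha \subset L -> propagation_closed phi L ->
  unit_derives (cnf_with phi alpha) G ->
  G <> set0 /\ forall l, G = [set l] -> l \in L.
Proof.
move=> consL /subsetP sub clL.
have main D C : D \in cnf_with phi alpha -> C \subset D ->
    falsified L (D :\: C) -> C <> set0 /\ forall l, C = [set l] -> l \in L.
  case/setUP=> [/clL[nf cl]|/imsetP[l la ->]] CD fal.
    split=> [C0|l Cl]; first by move: fal nf; rewrite C0 setD0 => ->.
    by apply: cl; rewrite -?Cl //; move: CD; rewrite Cl sub1set.
  have lL := sub _ la.
  split=> [C0|x Cx]; last by move: CD; rewrite Cx sub1set inE => /eqP ->.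
  move/falsifiedP: fal => /(_ l); rewrite C0 setD0 set11 => /(_ isT).
  by rewrite (negbTE (consL _ lL)).
suff inv C : unit_derives (cnf_with phi alpha) C ->
    exists D, [/\ D \in cnf_with phi alpha, C \subset D & falsified L (D :\: C)].
  by move=> /inv[D [Din GD fal]]; exact: main Din GD fal.
elim=> {C} [C Cin|C l _ [D [Din CD /falsifiedP fal]] lC _ [D' [Din' lD' fal']]].
  by exists C; split=> //; rewrite setDv; apply/falsifiedP => x; rewrite inE.
exists D; split=> //; first exact: subset_trans (subD1set _ _) CD.
apply/falsifiedP => x; rewrite !inE negb_and negbK => /andP[/orP[/eqP ->|xC] xD].
  (* The unit premise satisfies the invariant too, so [main] puts its literal [neg_lit l] in [L]. *)
  by have [_] := main _ _ Din' lD' fal'; exact.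
by apply: fal; rewrite inE xC xD.
Qed.

(** * Propagation using few clauses *)

(** Loop invariant of propagation from [alpha]: each clause of [theta] is paid for by a literal of
    [L] outside [alpha], and [theta] alone derives all of [L]. *)
Definition propagated phi alpha theta L : Prop :=
  [/\ theta \subset phi, alpha \subset L, partial_assignment L,
      #|theta| + #|alpha| <= #|L| &
      forall l, l \in L -> unit_derives (cnf_with theta alpha) [set l]].

(* A clause that is unit under L but not falsified adds a new variable to L;
   since L is consistent, this happens at most n times. *)
Lemma propagated_saturate phi alpha :
  partial_assignment alpha ->
  exists theta L, propagated phi alpha theta L /\
    (propagation_closed phi L \/ exists2 D, D \in phi & falsified L D).
Proof.
move=> cons_alpha.
suff ext k : forall theta L, n - #|L| < k -> propagated phi alpha theta L ->
    exists theta L, propagated phi alpha theta L /\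
    (propagation_closed phi L \/ exists2 D, D \in phi & falsified L D).
  apply: (ext n.+1 set0 alpha); first exact: leq_subr.
  by split; rewrite ?sub0set ?cards0 // => l; exact: unit_derives_assumption.
elim: k => // k IH theta L lek propL.
have [sub_theta sub_alpha consL card_theta derL] := propL.
have [/exists_inP[D Dphi fal]|/exists_inPn nofal] :=
  boolP [exists D in phi, falsified L D].
  by exists theta, L; split=> //; right; exists D.
have [/exists_inP[D Dphi /exists_inP[l lD /andP[fal lL]]]|noext] :=
  boolP [exists D in phi, exists l in D, falsified L (D :\ l) && (l \notin L)].
  (* Otherwise all of [D] would be falsified. *)
  have nlL : neg_lit l \notin L.
    apply/negP => nlL; move/negP: (nofal _ Dphi); apply.
    apply/falsifiedP => x xD; case: (eqVneq x l) => [->//|xl].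
    by move/falsifiedP: fal; apply; rewrite !inE xl.
  have consLl : partial_assignment (l |: L).
    move=> x; rewrite !inE => /orP[/eqP ->|xL].
      by rewrite (negbTE nlL) orbF neg_lit_neq.
    rewrite (negbTE (consL _ xL)) orbF; apply/eqP => E.
    by move: nlL; rewrite -E neg_litK xL.
  have := card_partial_assignment consLl; have := cardsU1 l L.
  rewrite lL add1n => cardLl leLl.
  apply: (IH (D |: theta) (l |: L)); first lia.
  have le_theta := cardsU1 D theta; split=> //.
  - by rewrite subUset sub1set Dphi.
  - exact: subset_trans sub_alpha (subsetUr _ _).
  - by case: (D \notin theta) le_theta; lia.
  have derL' x : x \in L -> unit_derives (cnf_with (D |: theta) alpha) [set x].
    by move/derL; apply: unit_derivesS; apply: cnf_withS; exact: subsetUr.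
  move=> x /setU1P[->|/derL' //].
  by apply: unit_derives_unit derL' lD fal; rewrite !inE eqxx.
exists theta, L; split=> //; left=> D Dphi; split; first exact: nofal.
move=> l lD fal; move/exists_inPn: noext => /(_ _ Dphi) /exists_inPn /(_ _ lD).
by rewrite fal /= negbK.
Qed.

(** Saturation uses at most [n - #|alpha|] clauses, and a falsified clause may add one. Without
    conflict, closure of [L] and [#|G| <= 1] force [G] to be a unit clause whose literal is in
    [L]. *)
Lemma unit_derives_core phi alpha G :
  partial_assignment alpha -> #|G| <= 1 ->
  unit_derives (cnf_with phi alpha) G ->
  exists theta, [/\ theta \subset phi, #|theta| + #|alpha| <= n.+1 &
    unit_derives (cnf_with theta alpha) G \/
    unit_derives (cnf_with theta alpha) set0].
Proof.
move=> cons_alpha leG derG.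
have [theta [L [[sub_theta sub_alpha consL card_theta derL] endL]]] :=
  propagated_saturate phi cons_alpha.
have cardL := card_partial_assignment consL.
case: endL => [clL|[D Dphi fal]].
  exists theta; split=> //; first by rewrite ltnW // ltnS (leq_trans card_theta).
  left; have [G0 Gl] := unit_derives_closed consL sub_alpha clL derG.
  have /cards1P[l lG] : #|G| == 1.
    by rewrite eqn_leq leG card_gt0; apply/eqP.
  by rewrite lG; apply: derL; exact: Gl.
exists (D |: theta); split.
- by rewrite subUset sub1set Dphi.
- by rewrite cardsU1; case: (D \notin theta); lia.
right; apply: (@unit_derives_falsified _ D L) => //; first by rewrite !inE eqxx.
by move=> x /derL; apply: unit_derivesS; apply: cnf_withS; exact: subsetUr.
Qed.

(** * Covering a clause by unit propagation *)

Definition negs C : {set lit n} := [set neg_lit l | l in C].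

Lemma mem_negs C l : (l \in negs C) = (neg_lit l \in C).
Proof. by rewrite -[l in LHS]neg_litK (mem_imset _ _ (inv_inj neg_litK)). Qed.

Lemma card_negs C : #|negs C| = #|C|.
Proof. exact: card_imset (inv_inj neg_litK). Qed.

Lemma negs_subset C L : (negs C \subset L) = falsified L C.
Proof.
apply/subsetP/falsifiedP => sub l; last first.
  by rewrite mem_negs => /sub; rewrite neg_litK.
by move=> lC; apply: sub; rewrite mem_negs neg_litK.
Qed.

(** This is absorption of [C] by [theta], as in clause learning. The empty clause has its own
    conjunct because the other one is vacuous for it. *)
Definition covers theta C : Prop :=
  (C = set0 -> unit_derives (cnf_with theta set0) set0) /\
  forall l, l \in C ->
    unit_derives (cnf_with theta (negs (C :\ l))) [set l] \/
    unit_derives (cnf_with theta (negs (C :\ l))) set0.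

Lemma coversS phi theta C : theta \subset phi -> covers theta C -> covers phi C.
Proof.
move=> sub [H0 H1]; split=> [/H0|l /H1].
  by apply: unit_derivesS; exact: cnf_withS.
by case=> [der|der]; [left|right]; apply: unit_derivesS der; exact: cnf_withS.
Qed.

(** If [L] falsifies [C :\ l], it contains the assumptions from which [theta] derives [l] or a
    conflict, so its closure under [theta] gives [l]. Tautological clauses never propagate anything
    new from a consistent [L]. *)
Lemma propagation_closed_covers phi theta L :
  partial_assignment L ->
  (forall C, C \in phi -> ~~ tautological C -> covers theta C) ->
  propagation_closed theta L -> propagation_closed phi L.
Proof.
move=> consL cov clL C Cphi.
have [/exists_inP[x xC nxC]|ntaut] := boolP (tautological C).
  split=> [|l lC /falsifiedP fal].
    apply/negP => /falsifiedP fal; move: (fal _ nxC); rewrite neg_litK => xL.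
    by move: (consL _ xL); rewrite fal.
  have [xl|xl] := eqVneq x l.
    by rewrite -xl -(neg_litK x); apply: fal; rewrite !inE -xl neg_lit_neq.
  have [<-|nxl] := eqVneq (neg_lit x) l; first by apply: fal; rewrite !inE xl.
  have xL : x \in L by rewrite -(neg_litK x); apply: fal; rewrite !inE nxl.
  by move: (consL _ xL); rewrite fal // !inE xl.
have [cov0 covl] := cov _ Cphi ntaut.
have unitL l : l \in C -> falsified L (C :\ l) -> l \in L.
  move=> lC; rewrite -negs_subset => sub.
  case: (covl _ lC) => /(unit_derives_closed consL sub clL)[// _].
  exact.
split=> //; apply/negP => fal.
have [C0|[l lC]] := set_0Vmem C.
  by have [] := unit_derives_closed consL (sub0set _) clL (cov0 C0).
have lL : l \in L.
  apply: unitL => //; apply/falsifiedP => x /setD1P[_ xC].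
  exact: (falsifiedP _ _ fal).
by move: (consL _ lL); rewrite (falsifiedP _ _ fal).
Qed.

(** * Models as closed literal sets, and transfer of equivalence and completeness *)

Definition true_lits a : {set lit n} := [set l | a l.1 == l.2].

Lemma partial_assignment_true_lits a : partial_assignment (true_lits a).
Proof. by move=> [x b]; rewrite !inE /= => /eqP ->; case: b. Qed.

Lemma falsified_true_lits a C : falsified (true_lits a) C = ~~ eval_clause C a.
Proof.
rewrite negb_exists_in; apply: eq_forallb_in => l _.
by rewrite inE /=; case: (a l.1); case: (l.2).
Qed.

(** Satisfaction becomes a case of closure, so the covering argument also yields logical
    consequence. *)
Lemma propagation_closed_true_lits phi a :
  propagation_closed phi (true_lits a) <-> eval_cnf phi a.
Proof.
split=> [cl|/forall_inP ev C /ev evC].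
  by apply/forall_inP => C /cl[]; rewrite falsified_true_lits negbK.
rewrite falsified_true_lits negbK; split=> // l lC /falsifiedP fal.
have /exists_inP[x xC ax] := evC; have [<-|xl] := eqVneq x l; first by rewrite inE.
have := fal x; rewrite !inE xl xC /= (eqP ax) => /(_ isT).
by case: (x.2).
Qed.

Lemma eval_cnf_with phi alpha a :
  eval_cnf (cnf_with phi alpha) a = eval_cnf phi a && (alpha \subset true_lits a).
Proof.
apply/forall_inP/andP => [ev|[/forall_inP ev /subsetP sub] C].
  split; first by apply/forall_inP => C Cphi; apply: ev; rewrite inE Cphi.
  apply/subsetP => l la.
  have /ev/exists_inP[x] : [set l] \in cnf_with phi alpha.
    by rewrite inE; apply/orP; right; apply/imsetP; exists l.
  by rewrite !inE => /eqP ->.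
case/setUP=> [/ev //|/imsetP[l /sub]]; rewrite inE => al ->.
by apply/exists_inP; exists l; rewrite ?set11.
Qed.

Lemma entails_cnf_with phi theta alpha C :
  eval_cnf phi =1 eval_cnf theta ->
  entails (cnf_with phi alpha) C -> entails (cnf_with theta alpha) C.
Proof. by move=> E ent a; rewrite eval_cnf_with -E -eval_cnf_with; exact: ent. Qed.

Lemma eval_cnfS phi theta a : theta \subset phi -> eval_cnf phi a -> eval_cnf theta a.
Proof.
by move=> /subsetP sub /forall_inP ev; apply/forall_inP => C /sub; exact: ev.
Qed.

Lemma eval_cnf_covers phi theta a :
  (forall C, C \in phi -> ~~ tautological C -> covers theta C) ->
  eval_cnf theta a -> eval_cnf phi a.
Proof.
move=> cov /propagation_closed_true_lits cl; apply/propagation_closed_true_lits.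
apply: propagation_closed_covers cov cl; exact: partial_assignment_true_lits.
Qed.

(** Saturating under [theta] gives a conflict or a set closed under [phi] as well; in the latter
    case whatever literal [phi] derives is already in the set, hence derived by [theta]. *)
Lemma PC_covers phi theta :
  eval_cnf phi =1 eval_cnf theta ->
  (forall C, C \in phi -> ~~ tautological C -> covers theta C) ->
  PC phi -> PC theta.
Proof.
move=> E cov pc alpha l cons_alpha ent.
have [theta' [L [[sub_theta sub_alpha consL _ derL] endL]]] :=
  propagated_saturate theta cons_alpha.
have {}derL x : x \in L -> unit_derives (cnf_with theta alpha) [set x].
  by move/derL; apply: unit_derivesS; exact: cnf_withS.
case: endL => [clL|[D Dtheta fal]]; last first.
  right; apply: unit_derives_falsified derL fal; by rewrite inE Dtheta.
have clL' := propagation_closed_covers consL cov clL.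
have := pc _ _ cons_alpha (entails_cnf_with (fsym E) ent).
case=> /(unit_derives_closed consL sub_alpha clL')[// _ Gl].
by left; apply: derL; exact: Gl.
Qed.

(* If [C] has k > 0 literals, each of them needs at most n + 2 - k clauses, and
   k * (n + 2 - k) <= n ^ 2 unless n = k = 1. *)
Lemma covers_core phi C :
  PC phi -> entails phi C -> ~~ tautological C -> (C = set0 -> 1 < n) ->
  exists theta, [/\ theta \subset phi, #|theta| <= n ^ 2 & covers theta C].
Proof.
move=> pc ent /tautologicalPn consC n_gt1.
have [C0|[l0 l0C]] := set_0Vmem C.
  have {}n_gt1 := n_gt1 C0.
  have cons0 : partial_assignment (set0 : {set lit n}) by move=> l; rewrite inE.
  have ent0 G : entails (cnf_with phi set0) G.
    move=> a; rewrite eval_cnf_with => /andP[/ent].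
    by rewrite C0 => /exists_inP[l]; rewrite inE.
  have der0 : unit_derives (cnf_with phi set0) set0.
    (* Propagation completeness speaks of literals only, so a complementary pair on some variable is
       derived and resolved. *)
    pose l : lit n := (Ordinal n_gt1, true).
    have [derl|//] := pc _ l cons0 (ent0 _).
    have [dernl|//] := pc _ (neg_lit l) cons0 (ent0 _).
    rewrite -[X in unit_derives _ X](setDv [set l]).
    by apply: unit_derives_setD => // x /set1P ->.
  have le0 : #|set0 : clause n| <= 1 by rewrite cards0.
  have [theta [sub card_theta der]] := unit_derives_core cons0 le0 der0.
  rewrite cards0 in card_theta.
  (* Here [n.+1 <= n ^ 2] uses [1 < n]. *)
  exists theta; split=> //; first by nia.
  by split=> [_|l]; [case: der | rewrite C0 inE].
have cardC := card_partial_assignment consC.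
(* For [n = 1] the count [k * (n + 2 - k)] is 2, but one clause suffices: a clause [D] of [phi]
   falsified when [l0] is false can only be [[set l0]] or empty. *)
have [n1|n_neq1] := eqVneq n 1.
  have Cl : C = [set l0].
    apply/esym/eqP; rewrite eqEcard sub1set l0C cards1 /=.
    by apply: leq_trans cardC _; rewrite n1.
  pose a := [ffun _ : 'I_n => ~~ l0.2].
  have one_var (x y : 'I_n) : x = y.
    by apply/val_inj; have := ltn_ord x; have := ltn_ord y; rewrite /=; lia.
  have /forall_inPn[D Dphi nD] : ~~ eval_cnf phi a.
    apply/negP => /ent /exists_inP[l]; rewrite Cl inE => /eqP -> .
    by rewrite ffunE; case: (l0.2).
  have sD l : l \in D -> l = l0.
    move=> lD; move/exists_inPn: nD => /(_ _ lD); rewrite ffunE.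
    case: l {lD} => x b /=; rewrite (one_var x l0.1) [l0 in RHS]surjective_pairing.
    by case: b; case: (l0.2).
  exists [set D]; split; rewrite ?sub1set ?cards1 ?n1 //.
  split=> [C0|l]; first by rewrite C0 inE in l0C.
  rewrite {1}Cl => /set1P -> .
  have Dth alpha : D \in cnf_with [set D] alpha by rewrite !inE eqxx.
  have [D0|[x xD]] := set_0Vmem D.
    by right; apply: unit_derives_in; rewrite -[X in X \in _]D0 Dth.
  left; apply: unit_derives_in; suff <- : D = [set l0] by rewrite Dth.
  apply/setP=> y; rewrite inE; apply/idP/eqP => [/sD //|->].
  by rewrite -(sD _ xD).
(* Membership of [l] stands under the quantifier so that [fin_all_exists] yields a choice function
   on all literals. The [n.+2] arises because only [#|C| - 1] literals are assumed. *)
have core l : exists theta, l \in C ->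
    [/\ theta \subset phi, #|theta| + #|C| <= n.+2 &
        unit_derives (cnf_with theta (negs (C :\ l))) [set l] \/
        unit_derives (cnf_with theta (negs (C :\ l))) set0].
  have [lC|lC] := boolP (l \in C); last by exists set0.
  have consCl : partial_assignment (negs (C :\ l)).
    move=> x; rewrite !mem_negs => /setD1P[_ /consC].
    by apply: contra => /setD1P[].
  have cardCl : #|negs (C :\ l)|.+1 = #|C| by rewrite card_negs [in RHS](cardsD1 l) lC.
  have entl : entails (cnf_with phi (negs (C :\ l))) [set l].
    move=> a; rewrite eval_cnf_with negs_subset => /andP[/ent/exists_inP[x xC ax]].
    move=> /falsifiedP fal; have [xl|xl] := eqVneq x l.
      by apply/exists_inP; exists x; rewrite ?xl ?set11 // -xl.
    have := fal x; rewrite !inE xl xC (eqP ax) /= => /(_ isT).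
    by case: (x.2).
  have [der|der] := pc _ _ consCl entl.
    have le1 : #|[set l]| <= 1 by rewrite cards1.
    have [theta [sub card_theta derth]] := unit_derives_core consCl le1 der.
    by exists theta; split=> //; rewrite -cardCl addnS ltnS.
  have le0 : #|set0 : clause n| <= 1 by rewrite cards0.
  have [theta [sub card_theta derth]] := unit_derives_core consCl le0 der.
  exists theta; split=> //; first by rewrite -cardCl addnS ltnS.
  by right; case: derth.
have [F FP] := fin_all_exists core.
exists (\bigcup_(l in C) F l); split.
- by apply/bigcupsP => l /FP[].
- have le_sum : #|\bigcup_(l in C) F l| <= \sum_(l in C) (n.+2 - #|C|).
    apply: leq_trans (card_bigcup_leq _ _) _.
    by apply: leq_sum => l /FP[_ le _]; lia.
  apply: leq_trans le_sum _; rewrite sum_nat_const.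
  have : 0 < #|C| by rewrite card_gt0; apply/set0Pn; exists l0.
  by nia.
split=> [C0|l lC]; first by rewrite C0 inE in l0C.
have sub : F l \subset \bigcup_(l in C) F l by exact: bigcup_sup.
have [_ _] := FP _ lC.
by case=> [der|der]; [left|right]; apply: unit_derivesS der; exact: cnf_withS.
Qed.

End UnitPropagation.

(* The hypothesis nondeg excludes only n <= 1 with the empty clause in phi1,
   where the bound is false: for n = 1, {bot} and {x, ~x} are both
   PC-irredundant and represent the constant 0; for n = 0, take {bot} twice. *)
Theorem theorem4 (n : nat) (phi1 phi2 : cnf n)
    (f : {ffun 'I_n -> bool} -> bool)
    (irr1 : PC_irredundant phi1) (irr2 : PC_irredundant phi2)
    (rep1 : represents phi1 f) (rep2 : represents phi2 f)
    (nondeg : set0 \in phi1 -> 1 < n) :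
  #|phi2| <= n ^ 2 * #|phi1|.
Proof.
have [pc1 _] := irr1; have [pc2 irred2] := irr2.
have eq12 : eval_cnf phi1 =1 eval_cnf phi2 by move=> a; rewrite rep1 rep2.
have core C : exists theta : cnf n, C \in phi1 ->
    [/\ theta \subset phi2, #|theta| <= n ^ 2 &
        ~~ tautological C -> covers theta C].
  have [Cphi|] := boolP (C \in phi1); last by exists set0.
  have [tautC|ntaut] := boolP (tautological C).
    (* Tautological clauses need no covering, hence no clauses. *)
    by exists set0; rewrite sub0set cards0.
  have ent2 : entails phi2 C by move=> a; rewrite -eq12 => /forall_inP; apply.
  have n_gt1 : C = set0 -> 1 < n by move=> C0; apply: nondeg; rewrite -C0.
  by have [theta []] := covers_core pc2 ent2 ntaut n_gt1; exists theta.
have [F FP] := fin_all_exists core.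
set theta := \bigcup_(C in phi1) F C.
have sub_theta : theta \subset phi2 by apply/bigcupsP => C /FP[].
have cov (phi : cnf n) : theta \subset phi ->
    forall C, C \in phi1 -> ~~ tautological C -> covers phi C.
  move=> sub C Cphi ntaut; have [_ _ /(_ ntaut)] := FP _ Cphi.
  by apply: coversS; apply: subset_trans sub; exact: bigcup_sup.
(* Were [C] outside [theta], [phi2 :\ C] would still cover [phi1], hence be equivalent to [phi2] and
   PC, against irredundancy. *)
have theta_all : phi2 \subset theta.
  apply/subsetP => C Cphi2; apply/negPn/negP => Ctheta.
  have sub : theta \subset phi2 :\ C by rewrite subsetD1 sub_theta.
  have eq2 : eval_cnf (phi2 :\ C) =1 eval_cnf phi2.
    move=> a; apply/idP/idP; last by apply: eval_cnfS; exact: subD1set.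
    by rewrite -eq12; apply: eval_cnf_covers; exact: cov.
  case: (irred2 _ Cphi2); apply=> //.
  apply: (PC_covers _ (cov _ sub) pc1) => a.
  by rewrite eq12 eq2.
apply: leq_trans (subset_leq_card theta_all) _.
apply: leq_trans (card_bigcup_leq _ _) _.
rewrite mulnC -sum_nat_const.
by apply: leq_sum => C /FP[].
Qed.
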